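(* Let $V$ be an $\ell$-Volterra quadratic stochastic operator on $S^{m-1}$ with heredity coefficients $P_{ij,k}$ and associated coefficients $a_{ki}$. Let $p,q,r\in E$ be distinct and put $$\Delta=(a_{pr}-a_{pp})(a_{qr}-a_{qq})-(a_{pr}-a_{pq})(a_{qr}-a_{qp}),$$ $$\Delta_1=a_{qr}a_{pq}-a_{pr}a_{qq},\qquad \Delta_2=a_{pr}a_{qp}-a_{qr}a_{pp}.$$ Suppose that (a) $\{p,q,r\}\cap\{\ell+1,\dots,m\}$ contains at most one element, say $r$ (so that $p,q\in\{1,\dots,\ell\}$); (b) $P_{ij,k}=0$ for all $i,j\in\{p,q,r\}$ and $k\in\{\ell+1,\dots,m\}\setminus\{p,q,r\}$; (c) $\Delta\ne 0$ and $\mathrm{sign}(\Delta)=\mathrm{sign}(\Delta_1)=\mathrm{sign}(\Delta_2)=\mathrm{sign}(\Delta-\Delta_1-\Delta_2)$. Then the (relative) interior of the two-dimensional face $S^2_{pqr}$ of $S^{m-1}$ spanned by the vertices $e^{(p)},e^{(q)},e^{(r)}$, that is, $\{x\in S^{m-1}: x_p,x_q,x_r>0,\ x_p+x_q+x_r=1\}$, contains exactly one fixed point of $V$.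
   Context: Let $E=\{1,\dots,m\}$ and $S^{m-1}=\{x\in\mathbb{R}^m: x_i\ge 0,\ \sum_{i=1}^m x_i=1\}$, with vertices $e^{(i)}$ (the standard basis vectors). A quadratic stochastic operator is a map $V:S^{m-1}\to S^{m-1}$, $V(x)_k=\sum_{i,j=1}^m P_{ij,k}x_ix_j$, where the heredity coefficients satisfy $P_{ij,k}\ge 0$, $P_{ij,k}=P_{ji,k}$, $\sum_{k=1}^m P_{ij,k}=1$ for all $i,j,k\in E$. For a fixed $\ell\in E$, $V$ is called $\ell$-Volterra if (i) $P_{ij,k}=0$ whenever $k\in\{1,\dots,\ell\}$, $i,j\in E$ and $k\notin\{i,j\}$; and (ii) for every $k\in\{\ell+1,\dots,m\}$ there is at least one pair $(i,j)$ with $i\ne k$, $j\ne k$ and $P_{ij,k}>0$. Its associated coefficients are $a_{ki}=2P_{ik,k}-1$ for $k\ne i$ and $a_{kk}=P_{kk,k}-1$ ($k,i\in E$). A fixed point of $V$ is $x\in S^{m-1}$ with $V(x)=x$. *)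

(* Defs.v *)
From HB Require Import structures.
From mathcomp Require Import all_boot all_order all_algebra.
From mathcomp Require Import reals.

Set Implicit Arguments.
Unset Strict Implicit.
Unset Printing Implicit Defensive.

Import Order.TTheory GRing.Theory Num.Theory.

Local Open Scope ring_scope.

(* The index set E = {1, ..., m} is 'I_m, numbered from 0:
   k : 'I_m stands for k + 1, so that {1, ..., l} is [set k | k < l] and
   {l + 1, ..., m} is [set k | l <= k]. *)

Definition simplex (R : realType) (m : nat) (x : 'rV[R]_m) : Prop :=
  (forall i, 0 <= x 0 i) /\ \sum_(i < m) x 0 i = 1.

(* heredity_fun P i j k is P_{ij,k}. *)
Record heredity (R : realType) (m : nat) := Heredity {
  heredity_fun :> 'I_m -> 'I_m -> 'I_m -> R;
  heredity_ge0 : forall i j k, 0 <= heredity_fun i j k;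
  heredity_sym : forall i j k, heredity_fun i j k = heredity_fun j i k;
  heredity_sum1 : forall i j, \sum_(k < m) heredity_fun i j k = 1
}.

(* The quadratic map is defined on all of R^m; by qso_simplex it restricts to
   a map of the simplex to itself. *)
Definition qso (R : realType) (m : nat) (P : heredity R m) (x : 'rV[R]_m) :
    'rV[R]_m :=
  \row_(k < m) \sum_(i < m) \sum_(j < m) P i j k * x 0 i * x 0 j.

Lemma qso_simplex (R : realType) (m : nat) (P : heredity R m) (x : 'rV[R]_m) :
  simplex x -> simplex (qso P x).
Proof.
move=> [x_ge0 x_sum1]; split=> [k|].
  rewrite mxE; apply: sumr_ge0 => i _; apply: sumr_ge0 => j _.
  by rewrite !mulr_ge0 ?heredity_ge0.
under eq_bigr do rewrite mxE.
rewrite exchange_big -[RHS]x_sum1; apply: eq_bigr => i _ /=.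
rewrite exchange_big -[RHS]mulr1 -x_sum1 mulr_sumr; apply: eq_bigr => j _ /=.
by rewrite -!mulr_suml heredity_sum1 mul1r.
Qed.

Definition fixed_point (R : realType) (m : nat) (V : 'rV[R]_m -> 'rV[R]_m)
    (x : 'rV[R]_m) : Prop :=
  simplex x /\ V x = x.

Definition l_Volterra (R : realType) (m l : nat) (P : heredity R m) : Prop :=
  (forall i j k : 'I_m, (k < l)%N -> k \notin [set i; j] -> P i j k = 0) /\
  (forall k : 'I_m, (l <= k)%N ->
     exists i j : 'I_m, [/\ i != k, j != k & 0 < P i j k]).

(* a_{ki} *)
Definition assoc_coef (R : realType) (m : nat) (P : heredity R m)
    (k i : 'I_m) : R :=
  if k == i then P k k k - 1 else 2 * P i k k - 1.

Definition face_interior (R : realType) (m : nat) (p q r : 'I_m)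
    (x : 'rV[R]_m) : Prop :=
  [/\ simplex x, 0 < x 0 p, 0 < x 0 q, 0 < x 0 r
    & x 0 p + x 0 q + x 0 r = 1].

(* Main.v *)
Require Import Defs.
From HB Require Import structures.
From mathcomp Require Import all_boot all_order all_algebra.
From mathcomp Require Import reals ring lra.

Set Implicit Arguments.
Unset Strict Implicit.
Unset Printing Implicit Defensive.

Import Order.TTheory GRing.Theory Num.Theory.

Local Open Scope ring_scope.

(** A coordinate [k] of Volterra type satisfies
    [V(x)_k = x_k * (1 + \sum_i a_{ki} x_i)] on the simplex
    ([qso_Volterra_coord]), so at a point with [x_k > 0] the quadratic equation
    [V(x)_k = x_k] becomes the linear one [\sum_i a_{ki} x_i = 0].

    Hypothesis (a) makes [p] and [q] of Volterra type.  The face is invariant: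
    for [k] outside [{p, q, r}] the coefficients [P_{ij,k}] with [i], [j] in
    [{p, q, r}] vanish, by the Volterra condition when [k] is among the first
    [l] indices and by (b) otherwise.  The coordinate [r], which need not be of
    Volterra type, is then settled by conservation of total mass.  So an
    interior point of the face is fixed exactly when the two linear equations
    for [p] and [q] hold ([fixed_face_interiorP]).

    Eliminating [x_r = 1 - x_p - x_q] leaves a 2 x 2 linear system of
    determinant [Delta], whose only solution is, by Cramer's rule,
    [x_p = Delta1 / Delta] and [x_q = Delta2 / Delta], whence
    [x_r = (Delta - Delta1 - Delta2) / Delta] ([barycentric_cramer]).  The sign
    condition (c) says that these three numbers are positive. *)

Lemma sum_supp3 (R : pzRingType) (I : finType) (p q r : I) (F : I -> R) :
  uniq [:: p; q; r] -> (forall i, i \notin [:: p; q; r] -> F i = 0) ->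
  \sum_i F i = F p + F q + F r.
Proof.
move=> pqr_uniq F0; rewrite (bigID (mem [:: p; q; r])) /=.
rewrite [X in _ + X = _]big1 ?addr0; last exact: F0.
by rewrite -big_uniq // !big_cons big_nil /= addr0 addrA.
Qed.

(** Nonnegative coordinates of total mass 1 leave nothing outside three
    coordinates that already carry mass 1. *)
Lemma face_interior_supp (R : realType) (m : nat) (p q r : 'I_m)
    (x : 'rV[R]_m) : uniq [:: p; q; r] -> face_interior p q r x ->
  forall i, i \notin [:: p; q; r] -> x 0 i = 0.
Proof.
move=> pqr_uniq [[x_ge0 x_sum1] _ _ _ x_pqr] i i_pqr.
have rest0 : \sum_(j | j \notin [:: p; q; r]) x 0 j = 0.
  move: x_sum1; rewrite (bigID (mem [:: p; q; r])) /= -big_uniq //.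
  by rewrite !big_cons big_nil /= addr0 addrA x_pqr => /(canRL (addKr _)) ->; ring.
by apply: (psumr_eq0P _ rest0) => // j _.
Qed.

(** Only the pairs [(k, k)], [(k, i)] and [(i, k)] contribute to coordinate [k].
    The last two have equal weight by symmetry, which is where the factor 2 in
    the associated coefficients comes from; their shift by 1 is compensated by
    the total mass of [x]. *)
Lemma qso_Volterra_coord (R : realType) (m : nat) (P : heredity R m)
    (k : 'I_m) (x : 'rV[R]_m) :
  (forall i j, k \notin [set i; j] -> P i j k = 0) -> \sum_i x 0 i = 1 ->
  qso P x 0 k = x 0 k * (1 + \sum_i assoc_coef P k i * x 0 i).
Proof.
move=> P0 x1; rewrite mxE -{1}x1 -big_split /= mulr_sumr.
rewrite (bigD1 k) //= [RHS](bigD1 k) //= (bigD1 k) //=.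
have -> : \sum_(i | i != k) \sum_j P i j k * x 0 i * x 0 j =
          \sum_(i | i != k) P i k k * x 0 i * x 0 k.
  apply: eq_bigr => i ik; rewrite (bigD1 k) //= big1 ?addr0 // => j jk.
  by rewrite P0 ?mul0r // !inE negb_or !(eq_sym k) ik.
rewrite -addrA -big_split /=; congr (_ + _).
  by rewrite /assoc_coef eqxx; ring.
apply: eq_bigr => i ik; rewrite /assoc_coef eq_sym (negbTE ik).
by rewrite (heredity_sym P k i); ring.
Qed.

Lemma fixed_Volterra_coordP (R : realType) (m : nat) (P : heredity R m)
    (k : 'I_m) (x : 'rV[R]_m) :
  (forall i j, k \notin [set i; j] -> P i j k = 0) -> \sum_i x 0 i = 1 ->
  0 < x 0 k ->
  qso P x 0 k = x 0 k <-> \sum_i assoc_coef P k i * x 0 i = 0.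
Proof.
move=> P0 x1 xk; rewrite qso_Volterra_coord //; split=> [|->]; last first.
  by rewrite addr0 mulr1.
by rewrite -[RHS]mulr1 => /(mulfI (lt0r_neq0 xk)) H; lra.
Qed.

(** The third equation is conservation of mass: both [x] and [V(x)] have total
    mass 1, so they agree at [r] as soon as they agree elsewhere. *)
Lemma fixed_face_interiorP (R : realType) (m : nat) (P : heredity R m)
    (p q r : 'I_m) (x : 'rV[R]_m) :
  uniq [:: p; q; r] ->
  (forall k, k \in [:: p; q] ->
     forall i j, k \notin [set i; j] -> P i j k = 0) ->
  (forall i j k, i \in [:: p; q; r] -> j \in [:: p; q; r] ->
     k \notin [:: p; q; r] -> P i j k = 0) ->
  face_interior p q r x ->
  qso P x = x <->
  (forall k, k \in [:: p; q] -> assoc_coef P k p * x 0 p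
     + assoc_coef P k q * x 0 q + assoc_coef P k r * x 0 r = 0).
Proof.
move=> pqr_uniq Volt_pq inv_pqr x_face.
have x0 := face_interior_supp pqr_uniq x_face.
case: (x_face) => x_simplex xp xq xr _; have x1 := x_simplex.2.
have sumE k : \sum_i assoc_coef P k i * x 0 i = assoc_coef P k p * x 0 p
     + assoc_coef P k q * x 0 q + assoc_coef P k r * x 0 r.
  by apply: sum_supp3 => // i /x0 ->; rewrite mulr0.
have x_gt0 k : k \in [:: p; q] -> 0 < x 0 k.
  by rewrite !inE => /orP[] /eqP ->.
split=> [Vx k k_pq | lin].
  rewrite -sumE; apply/fixed_Volterra_coordP; rewrite ?Vx //.
  - exact: Volt_pq.
  - exact: x_gt0.
have V_pq k : k \in [:: p; q] -> qso P x 0 k = x 0 k.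
  move=> k_pq; apply/fixed_Volterra_coordP => //; first exact: Volt_pq.
    exact: x_gt0.
  by rewrite sumE lin.
have V_out k : k \notin [:: p; q; r] -> qso P x 0 k = x 0 k.
  move=> k_pqr; rewrite mxE x0 // big1 // => i _; rewrite big1 // => j _.
  have [i_pqr|/x0->] := boolP (i \in [:: p; q; r]); last by rewrite mulr0 mul0r.
  have [j_pqr|/x0->] := boolP (j \in [:: p; q; r]); last by rewrite mulr0.
  by rewrite inv_pqr // !mul0r.
have V_neq_r k : k != r -> qso P x 0 k = x 0 k.
  move=> kr; have [k_pqr|] := boolP (k \in [:: p; q; r]); last exact: V_out.
  by apply: V_pq; move: k_pqr; rewrite !inE (negbTE kr) orbF.
apply/rowP => k; have [->|] := eqVneq k r; last exact: V_neq_r.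
have := (qso_simplex P x_simplex).2; rewrite -x1 (bigD1 r) //=.
by rewrite [RHS](bigD1 r) //= (eq_bigr _ V_neq_r) => /addIr.
Qed.

(** Cramer's rule for the 2 x 2 system obtained by substituting
    [w = 1 - u - v]. *)
Lemma barycentric_cramer (F : fieldType) (app apq apr aqp aqq aqr u v w : F) :
  let D := (apr - app) * (aqr - aqq) - (apr - apq) * (aqr - aqp) in
  let D1 := aqr * apq - apr * aqq in
  let D2 := apr * aqp - aqr * app in
  D != 0 -> u + v + w = 1 ->
  (app * u + apq * v + apr * w = 0 /\ aqp * u + aqq * v + aqr * w = 0) <->
  (u = D1 / D /\ v = D2 / D).
Proof.
move=> D D1 D2 D0 uvw; have -> : w = 1 - u - v by rewrite -uvw; ring.
split=> [[Ep Eq] | [-> ->]]; last first.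
  by split; rewrite /D1 /D2 /D; field; rewrite -/D.
split; apply: (canRL (mulfK D0)); apply/eqP; rewrite -subr_eq0; apply/eqP.
  transitivity ((app * u + apq * v + apr * (1 - u - v)) * (aqq - aqr)
              - (aqp * u + aqq * v + aqr * (1 - u - v)) * (apq - apr)).
    by rewrite /D /D1; ring.
  by rewrite Ep Eq; ring.
transitivity ((aqp * u + aqq * v + aqr * (1 - u - v)) * (app - apr)
            - (app * u + apq * v + apr * (1 - u - v)) * (aqp - aqr)).
  by rewrite /D /D2; ring.
by rewrite Ep Eq; ring.
Qed.

Lemma divr_gt0_sg (R : realFieldType) (x y : R) :
  y != 0 -> Num.sg x = Num.sg y -> 0 < x / y.
Proof. by move=> y0 sxy; rewrite -sgr_gt0 sgrM sgrV sxy -expr2 sqr_sg y0. Qed.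

Lemma face_interior_exists (R : realType) (m : nat) (p q r : 'I_m) (u v w : R) :
  uniq [:: p; q; r] -> 0 < u -> 0 < v -> 0 < w -> u + v + w = 1 ->
  exists x : 'rV[R]_m,
    [/\ face_interior p q r x, x 0 p = u, x 0 q = v & x 0 r = w].
Proof.
move=> pqr_uniq u0 v0 w0 uvw.
pose x : 'rV[R]_m :=
  \row_i (if i == p then u else if i == q then v else if i == r then w else 0).
have [pq pr qr] : [/\ p != q, p != r & q != r].
  by move: pqr_uniq; rewrite /= !inE negb_or andbT => /andP[/andP[]].
have xp : x 0 p = u by rewrite mxE eqxx.
have xq : x 0 q = v by rewrite mxE eq_sym (negbTE pq) eqxx.
have xr : x 0 r = w.
  by rewrite mxE eq_sym (negbTE pr) eq_sym (negbTE qr) eqxx.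
exists x; split=> //; split; rewrite ?xp ?xq ?xr //; split=> [i|].
  by rewrite mxE; do 3?case: ifP => _ //; apply: ltW.
rewrite (sum_supp3 pqr_uniq) ?xp ?xq ?xr // => i.
by rewrite !inE !negb_or mxE => /and3P[/negbTE-> /negbTE-> /negbTE->].
Qed.

Theorem theorem7 (R : realType) (m l : nat) (hl : (0 < l <= m)%N)
    (P : heredity R m) (hV : l_Volterra l P)
    (p q r : 'I_m) (hpqr : uniq [:: p; q; r]) :
  let a := assoc_coef P in
  let Delta := (a p r - a p p) * (a q r - a q q)
             - (a p r - a p q) * (a q r - a q p) in
  let Delta1 := a q r * a p q - a p r * a q q in
  let Delta2 := a p r * a q p - a q r * a p p in
  [set p; q; r] :&: [set k : 'I_m | (l <= k)%N] \subset [set r] ->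
  (forall i j k : 'I_m, i \in [set p; q; r] -> j \in [set p; q; r] ->
     k \in [set k : 'I_m | (l <= k)%N] :\: [set p; q; r] -> P i j k = 0) ->
  [/\ Delta != 0, Num.sg Delta = Num.sg Delta1,
      Num.sg Delta1 = Num.sg Delta2
    & Num.sg Delta2 = Num.sg (Delta - Delta1 - Delta2)] ->
  exists! x : 'rV[R]_m, face_interior p q r x /\ fixed_point (qso P) x.
Proof.
move=> a Delta Delta1 Delta2 ha hb [D0 s1 s2 s3].
have mem_pqr i : (i \in [set p; q; r]) = (i \in [:: p; q; r]).
  by rewrite !inE orbA.
have Volt_pq k : k \in [:: p; q] ->
    forall i j, k \notin [set i; j] -> P i j k = 0.
  move=> k_pq i j; apply: hV.1; rewrite ltnNge; apply/negP => lk.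
  have : k \in [set r].
    apply: (subsetP ha); rewrite inE mem_pqr [k \in [set _ | _]]inE lk andbT.
    by move: k_pq; rewrite !inE => /orP[->|->]; rewrite ?orbT.
  move/set1P => kr; move: hpqr k_pq; rewrite kr /= !inE negb_or andbT.
  by rewrite !(eq_sym r) => /andP[/andP[_ /negbTE->] /negbTE->].
have inv_pqr i j k : i \in [:: p; q; r] -> j \in [:: p; q; r] ->
    k \notin [:: p; q; r] -> P i j k = 0.
  move=> i_pqr j_pqr k_pqr; have [kl|lk] := ltnP k l.
    apply: hV.1 => //; apply/set2P => -[] k_eq; move: k_pqr.
      by rewrite k_eq i_pqr.
    by rewrite k_eq j_pqr.
  by apply: hb; rewrite ?mem_pqr // in_setD mem_pqr k_pqr inE.
have fixP x : face_interior p q r x ->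
    qso P x = x <-> (x 0 p = Delta1 / Delta /\ x 0 q = Delta2 / Delta).
  move=> x_face; case: (x_face) => _ _ _ _ x1.
  apply: iff_trans (barycentric_cramer D0 x1).
  apply: (iff_trans (fixed_face_interiorP hpqr Volt_pq inv_pqr x_face)).
  split=> [lin | [linp linq] k].
    by split; apply: lin; rewrite !inE eqxx ?orbT.
  by rewrite !inE => /orP[] /eqP ->.
have u0 : 0 < Delta1 / Delta by apply: divr_gt0_sg.
have v0 : 0 < Delta2 / Delta by apply: divr_gt0_sg => //; rewrite s1.
have w0 : 0 < (Delta - Delta1 - Delta2) / Delta.
  by apply: divr_gt0_sg => //; rewrite s1 s2.
have uvw : Delta1 / Delta + Delta2 / Delta
         + (Delta - Delta1 - Delta2) / Delta = 1.
  by rewrite -2!mulrDl -addrA subrKC addrC subrK divff.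
have [x [x_face xp xq xr]] := face_interior_exists hpqr u0 v0 w0 uvw.
exists x; split=> [|y [y_face [_ /(fixP _ y_face)[yp yq]]]].
  by split=> //; split; [case: x_face | apply/fixP].
have yr : y 0 r = (Delta - Delta1 - Delta2) / Delta.
  case: y_face => _ _ _ _; rewrite yp yq => y1.
  by apply: (@addrI _ (Delta1 / Delta + Delta2 / Delta)); rewrite y1 uvw.
apply/rowP => i; have [|i_pqr] := boolP (i \in [:: p; q; r]).
  by rewrite !inE => /or3P[] /eqP ->; rewrite ?xp ?yp ?xq ?yq ?xr ?yr.
by rewrite !(face_interior_supp hpqr _ i_pqr).
Qed.
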